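(* Let $(\Omega,\Sigma,\mathbb{P})$ be a nonatomic probability space and let $\mathcal{K}$ be a convex bounded subset of $\mathbb{L}^1(\mathbb{P})$. The following are equivalent. (1) There exists a probability measure $\mathbb{Q}\sim\mathbb{P}$ such that $\mathcal{K}$ is $\mathbb{Q}$-uniformly integrable. (2) For any $\varepsilon>0$, there exists a measurable set $A$ with $\mathbb{P}(A)>1-\varepsilon$ such that if $(X_n)$ is a sequence in $\mathcal{K}$ that is Cauchy in probability, then $\mathbb{E}_{\mathbb{P}}[|X_n-X_m|\mathbf{1}_A]\to 0$ as $n,m\to\infty$. (3) For any measurable set $A$ with $\mathbb{P}(A)>0$, there exists a measurable subset $B$ of $A$ with $\mathbb{P}(B)>0$ such that if $(X_n)$ is a sequence in $\mathcal{K}$ that is Cauchy in probability, then $\mathbb{E}_{\mathbb{P}}[|X_n-X_m|\mathbf{1}_B]\to 0$ as $n,m\to\infty$. (4) For any measurable set $A$ with $\mathbb{P}(A)>0$, there exists a measurable subset $B$ of $A$ with $\mathbb{P}(B)>0$ such that $\mathcal{K}_B:=\{X\mathbf{1}_B: X\in\mathcal{K}\}$ is $\mathbb{P}$-uniformly integrable.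
   Context: Bounded in $\mathbb{L}^1(\mathbb{P})$ means $\sup_{X\in\mathcal{K}}\mathbb{E}_{\mathbb{P}}[|X|]<\infty$. $\mathbb{Q}\sim\mathbb{P}$ means that $\mathbb{Q}$ is a probability measure on $(\Omega,\Sigma)$ mutually absolutely continuous with $\mathbb{P}$. Uniform integrability is in the usual probabilistic sense. *)

(* Defs.v *)
From HB Require Import structures.
From mathcomp Require Import all_boot all_order all_algebra.
From mathcomp Require Import all_classical all_reals all_analysis.
Set Implicit Arguments.
Unset Strict Implicit.
Unset Printing Implicit Defensive.
Import Order.TTheory GRing.Theory Num.Theory.
Import numFieldNormedType.Exports.
Local Open Scope classical_set_scope.
Local Open Scope ring_scope.
Local Open Scope ereal_scope.

Definition nonatomic {d : measure_display} {T : measurableType d}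
    {R : realType} (P : probability T R) : Prop :=
  forall A : set T, measurable A -> 0 < P A ->
    exists B : set T, [/\ measurable B, B `<=` A, 0 < P B & P B < P A].

(* Subsets of L^1(P) are given by sets of representatives, that is, of genuine
   functions [T -> R]; all the notions below are invariant under P-a.e.
   equality.  A set of equivalence classes corresponds to an a.e.-saturated set
   of representatives, which is convex iff the set of classes is. *)
Definition L1_bounded {d : measure_display} {T : measurableType d}
    {R : realType} (P : probability T R) (K : set (T -> R)) : Prop :=
  ereal_sup [set 'E_P[fun x => `|X x|%R] | X in K] < +oo.

(* [E_Q[|X| 1_{|X| > c}]] tends to 0 as [c] tends to [+oo], uniformly in
   [X \in K].  The supremum over [K] is spelled out as a uniform bound because
   [ereal_sup] of the empty set is [-oo].  Membership in L^1(Q) is not assumed: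
   it is a consequence. *)
Definition uniformly_integrable {d : measure_display} {T : measurableType d}
    {R : realType} (Q : probability T R) (K : set (T -> R)) : Prop :=
  (forall X, K X -> measurable_fun setT X) /\
  forall eps : R, (0 < eps)%R ->
    \forall c \near +oo%R, forall X, K X ->
      'E_Q[fun x => (`|X x| * \1_[set y | (c < `|X y|)%R] x)%R] <= eps%:E.

(* [(\oo, \oo)] is the product filter on [nat * nat]: [n] and [m] tend to
   infinity independently. *)
Definition cauchy_in_probability {d : measure_display} {T : measurableType d}
    {R : realType} (P : probability T R) (X : (T -> R)^nat) : Prop :=
  forall eps : R, (0 < eps)%R ->
    P [set x | (eps < `|X nm.1 x - X nm.2 x|)%R] @[nm --> (\oo, \oo)] --> 0.

Definition cauchy_in_L1_on {d : measure_display} {T : measurableType d}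
    {R : realType} (P : probability T R) (A : set T) (X : (T -> R)^nat) : Prop :=
  'E_P[fun x => (`|X nm.1 x - X nm.2 x| * \1_A x)%R] @[nm --> (\oo, \oo)] --> 0.

(* Main.v *)
(* (1) => (2): A is a set on which dP/dQ is bounded, and on a Q-uniformly
   integrable set Cauchy sequences in probability are Cauchy in L^1(Q).
   (2) => (3) intersects the two sets.
   (3) => (4) holds with the same B.  If K is not uniformly integrable on B, let
   eta > 0 be the largest mass that elements of K keep on B over arbitrarily
   small sets, and choose X_n in K with mass almost eta on S_n, where P(S_n)
   decreases fast.  By maximality of eta, X_n has little mass on the sets S_k,
   k > n or k < n, outside its own part of S_n; hence every convex combination
   of X_n, X_(n+1), ... still has mass at least eta/2 on S_n u S_(n+1) u ....
   By a Komlos-type argument some such combinations are Cauchy in probability,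
   but they are not Cauchy in L^1 on B.
   (4) => (1): exhaust the space by sets B_n on which K is uniformly integrable
   and normalize sum_n 2^-(n+1) P(. & B_n); L^1-boundedness controls the tail. *)

Require Import Defs.
From mathcomp Require Import all_boot all_order all_algebra.
From mathcomp Require Import all_classical all_reals all_analysis.
From mathcomp Require Import measurable_realfun ring lra.
Set Implicit Arguments.
Unset Strict Implicit.
Import Order.TTheory GRing.Theory Num.Theory.
Import numFieldNormedType.Exports.
Local Open Scope classical_set_scope.
Local Open Scope ring_scope.

(** * Double limits at infinity *)

Lemma cvge0_oo2P (R : realType) (f : nat * nat -> \bar R) :
  (forall nm, (0 <= f nm)%E) ->
  f nm @[nm --> (\oo, \oo)] --> 0%E <->
  forall e : R, 0 < e -> exists N : nat, forall n m : nat,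
    (N <= n)%N -> (N <= m)%N -> (f (n, m) <= e%:E)%E.
Proof.
move=> f0; split=> [|H].
  move=> /fine_cvgP[[[A B] [[N1 _ AN1] [N2 _ BN2]] ABf] /cvgrPdist_le H] e e0.
  have [[A' B'] [[N3 _ AN3] [N4 _ BN4]] ABf'] := H _ e0.
  exists (maxn (maxn N1 N2) (maxn N3 N4)) => n m.
  rewrite !geq_max => /andP[/andP[? ?] /andP[? ?]] /andP[/andP[? ?] /andP[? ?]].
  have ffin : f (n, m) \is a fin_num.
    by apply: ABf; split => /=; [exact: AN1|exact: BN2].
  rewrite -(fineK ffin) lee_fin.
  have /= : `|0 - fine (f (n, m))| <= e.
    by apply: (ABf' (n, m)); split => /=; [exact: AN3|exact: BN4].
  by rewrite sub0r normrN; apply: le_trans; exact: ler_norm.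
apply/fine_cvgP; split.
  (* The eventual finiteness demanded by [fine_cvgP] comes from the bound with [e = 1]. *)
  have [N HN] := H _ ltr01.
  exists ([set n | (N <= n)%N], [set n | (N <= n)%N]) => /=.
    by split; exists N.
  move=> -[n m] [/= Nn Nm]; rewrite ge0_fin_numE//.
  by rewrite (le_lt_trans (HN _ _ Nn Nm))// ltry.
apply/cvgrPdist_le => e /H[N HN].
exists ([set n | (N <= n)%N], [set n | (N <= n)%N]) => /=.
  by split; exists N.
move=> -[n m] [/= Nn Nm]; rewrite sub0r normrN ger0_norm ?fine_ge0//.
have := HN _ _ Nn Nm; have := f0 (n, m).
by case: (f (n, m)) => [r| |]//=; rewrite lee_fin.
Qed.

(** * Real-valued integrals over a probability space *)

Section probability.
Context d (T : measurableType d) (R : realType) (P : probability T R).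
Implicit Types (f g X Y : T -> R) (A B S : set T).
Local Notation integrable f := (P.-integrable setT (EFin \o f)).

Lemma integrable_probability_cst (r : R) : integrable (cst r).
Proof. exact: finite_measure_integrable_cst. Qed.

Lemma integrable_measurable f : integrable f -> measurable_fun setT f.
Proof. by move=> /measurable_int/measurable_EFinP. Qed.

Lemma integrable_setS f A : measurable A -> integrable f ->
  P.-integrable A (EFin \o f).
Proof. by move=> mA; apply: integrableS => //. Qed.

Lemma integrable_dominated f g : measurable_fun setT f -> integrable g ->
  (forall x, `|f x| <= `|g x|) -> integrable f.
Proof.
move=> mf ig fg; apply: le_integrable ig => //; first exact/measurable_EFinP.
by move=> x _; rewrite lee_fin fg.
Qed.

Lemma integrable_add f g : integrable f -> integrable g ->
  integrable (fun x => f x + g x).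
Proof. by move=> fi gi; exact: (integrableD _ fi gi). Qed.

Lemma integrable_opp f : integrable f -> integrable (fun x => - f x).
Proof. by move=> fi; exact: (integrableN fi). Qed.

Lemma integrable_sub f g : integrable f -> integrable g ->
  integrable (fun x => f x - g x).
Proof. by move=> fi gi; exact/integrable_add/integrable_opp. Qed.

Lemma integrable_scale f (r : R) : integrable f -> integrable (fun x => r * f x).
Proof. by move=> fi; exact: (integrableZl _ r fi). Qed.

Lemma integrable_normr f : integrable f -> integrable (fun x => `|f x|).
Proof. exact: integrable_norm. Qed.

Lemma integrable_mul_indic f A : measurable A -> integrable f ->
  integrable (fun x => f x * \1_A x).
Proof.
move=> mA fi; apply: (integrable_dominated _ fi).
  by apply: measurable_funM => //; exact: integrable_measurable.
by move=> x; rewrite normrM ler_piMr// indicE; case: (_ \in _);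
  rewrite ?normr1 ?normr0.
Qed.

Lemma RintegralEFin f A : measurable A -> integrable f ->
  (\int[P]_(x in A) f x)%:E = (\int[P]_(x in A) (f x)%:E)%E.
Proof.
move=> mA fi; rewrite /Rintegral fineK//.
exact/integrable_fin_num/integrable_setS.
Qed.

Lemma RintegralS f A B : measurable A -> measurable B -> A `<=` B ->
  integrable f -> (forall x, 0 <= f x) ->
  \int[P]_(x in A) f x <= \int[P]_(x in B) f x.
Proof.
move=> mA mB AB fi f0; rewrite -lee_fin !RintegralEFin//.
apply: ge0_subset_integral => //.
- exact/measurable_funTS/measurable_EFinP/integrable_measurable.
- by move=> x _; rewrite lee_fin.
Qed.

Lemma expectationE f : integrable f -> 'E_P[f]%E = (\int[P]_x f x)%:E.
Proof. by move=> fi; rewrite unlock RintegralEFin. Qed.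

Lemma expectation_indicE f A : measurable A -> integrable f ->
  'E_P[fun x => (f x * \1_A x)%R]%E = (\int[P]_(x in A) f x)%:E.
Proof.
move=> mA fi; rewrite unlock RintegralEFin// [in RHS]integral_mkcond.
by apply: eq_integral => x _; rewrite epatch_indic.
Qed.

Lemma Rintegral_indicr f A B : measurable A -> measurable B -> integrable f ->
  \int[P]_(x in A) (f x * \1_B x) = \int[P]_(x in A `&` B) f x.
Proof. by move=> mA mB fi; rewrite Rintegral_mkcondr patch_indic. Qed.

Lemma measurable_gt_norm f (c : R) : measurable_fun setT f ->
  measurable [set x | c < `|f x|].
Proof.
move=> mf; rewrite -[X in measurable X]setTI.
by apply: measurable_fun_ltr => //; exact: measurableT_comp.
Qed.

Lemma measurable_gt_dist f g (c : R) : integrable f -> integrable g ->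
  measurable [set x | c < `|f x - g x|].
Proof.
move=> fi gi; apply: (@measurable_gt_norm (fun x => f x - g x)).
exact/integrable_measurable/integrable_sub.
Qed.

Lemma markov_Rintegral f (c : R) : 0 < c -> integrable f ->
  fine (P [set x | c < `|f x|]) <= (\int[P]_x `|f x|) / c.
Proof.
move=> c0 fi; rewrite ler_pdivlMr// mulrC.
have mf := integrable_measurable fi.
have mS := measurable_gt_norm c mf.
rewrite -[c in c * _]/((fun=> c) tt) -Rintegral_cst//.
apply: (@le_trans _ _ (\int[P]_(x in [set x | c < `|f x|]) `|f x|)).
  apply: le_Rintegral => //; first exact/integrable_setS/integrable_probability_cst.
    exact/integrable_setS/integrable_norm.
  by move=> x /= /ltW.
by apply: RintegralS => //; exact: integrable_norm.
Qed.

Lemma integrable_small_sets f (e : R) : integrable f -> 0 < e ->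
  exists2 r : R, 0 < r & forall S, measurable S -> (P S < r%:E)%E ->
    \int[P]_(x in S) `|f x| <= e.
Proof.
move=> fi e0; have [r [r0 H]] := integral_normr_continuous fi e0.
by exists r => // S mS /H => /(_ mS)/ltW.
Qed.

End probability.

(** The Euclidean length of the vector [(1, x)]: strictly convex, yet of linear growth, so that its
    expectation is finite on all of L^1. *)
Definition convex_norm {R : realType} (x : R) : R := Num.sqrt (1 + x ^+ 2).

(** * Quantitative strict convexity *)

Section convex_norm.
Context {R : realType}.
Implicit Types x y : R.

Lemma sqr_convex_norm x : convex_norm x ^+ 2 = 1 + x ^+ 2.
Proof. by rewrite sqr_sqrtr// addr_ge0// sqr_ge0. Qed.

Lemma convex_norm_gt0 x : 0 < convex_norm x.
Proof. by rewrite sqrtr_gt0 ltr_pwDl// sqr_ge0. Qed.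

Lemma convex_norm_le x : convex_norm x <= 1 + `|x|.
Proof.
rewrite -ler_sqr ?nnegrE ?(ltW (convex_norm_gt0 x)) ?addr_ge0//.
rewrite sqr_convex_norm -[x ^+ 2]real_normK ?num_real//.
by rewrite sqrrD expr1n mul1r lerD2r lerDl mulrn_wge0.
Qed.

Lemma measurable_convex_norm : measurable_fun setT (@convex_norm R).
Proof.
apply: (measurableT_comp (continuous_measurable_fun (@sqrt_continuous R))).
by apply: measurable_funD => //; exact: measurable_funX.
Qed.

(* With [a = (1, x)] and [b = (1, y)] in the Euclidean plane, the gap
   [|a| + |b| - |a + b|] is controlled from below by [det(a, b)^2 = (x - y)^2]. *)
Lemma convex_norm_gap x y :
  let gap := convex_norm x + convex_norm y - 2 * convex_norm ((x + y) / 2) in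
  0 <= gap /\
  (x - y) ^+ 2 <=
    gap * (2 * convex_norm x * convex_norm y * (convex_norm x + convex_norm y)).
Proof.
move=> gap; rewrite /gap {gap}.
have := sqr_convex_norm x; have := sqr_convex_norm y.
have := sqr_convex_norm ((x + y) / 2).
have := convex_norm_gt0 x; have := convex_norm_gt0 y.
have := convex_norm_gt0 ((x + y) / 2).
move: (convex_norm x) (convex_norm y) (convex_norm _) => a b c c0 b0 a0 cE bE aE.
have ab0 : 0 < a * b by exact: mulr_gt0.
(* Lagrange's identity for [(1, x)] and [(1, y)]: the product of the squared lengths is the squared
   inner product plus the squared determinant. *)
have abE : (a * b) ^+ 2 = (1 + x * y) ^+ 2 + (x - y) ^+ 2.
  by rewrite exprMn aE bE; ring.
have abxy : `|1 + x * y| <= a * b.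
  rewrite -ler_sqr ?nnegrE ?(ltW ab0)// real_normK ?num_real//.
  by rewrite abE lerDl sqr_ge0.
have /andP[abxyN abxyP] : - (a * b) <= 1 + x * y <= a * b by rewrite -ler_norml.
(* Since [2 * c] is the length of [(1, x) + (1, y)], the left-hand side is [(a + b) ^+ 2] minus the
   squared length of the sum, and only the cross terms differ. *)
have gapE : (a + b - 2 * c) * (a + b + 2 * c) = 2 * (a * b - (1 + x * y)).
  have -> : (a + b - 2 * c) * (a + b + 2 * c) =
    a ^+ 2 + b ^+ 2 + 2 * (a * b) - 4 * c ^+ 2 by ring.
  by rewrite aE bE cE; field.
have gap0 : 0 <= a + b - 2 * c.
  by rewrite -(pmulr_lge0 _ (_ : 0 < a + b + 2 * c)) ?gapE; lra.
split=> //.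
have -> : (x - y) ^+ 2 = (a * b - (1 + x * y)) * (a * b + (1 + x * y)).
  by apply: (addrI ((1 + x * y) ^+ 2)); rewrite -abE; ring.
apply: (@le_trans _ _ ((a * b - (1 + x * y)) * (2 * (a * b)))).
  by apply: ler_wpM2l; lra.
have -> : (a * b - (1 + x * y)) * (2 * (a * b)) =
  ((a + b - 2 * c) * (a + b + 2 * c)) * (a * b) by rewrite gapE; ring.
have -> : (a + b - 2 * c) * (2 * a * b * (a + b)) =
  ((a + b - 2 * c) * (2 * (a + b))) * (a * b) by ring.
apply: ler_wpM2r; first exact: ltW.
by apply: ler_wpM2l => //; lra.
Qed.

(** If [|x| + |y| <= c], both norms are at most [1 + c] and the factor in [convex_norm_gap] is at
    most [4 * (1 + c) ^+ 3]; otherwise the last summand alone exceeds the left-hand side. That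
    summand is linear in [|x| + |y|], so an L^1 bound controls it after integration. *)
Lemma convex_norm_gap_bound (a c x y : R) : 0 < a -> 0 < c ->
  a < `|x - y| ->
  a ^+ 2 / (4 * (1 + c) ^+ 3) <=
    convex_norm x + convex_norm y - 2 * convex_norm ((x + y) / 2)
    + a ^+ 2 / (4 * (1 + c) ^+ 3) / c * (`|x| + `|y|).
Proof.
move=> a0 c0 axy; have [gap0 gapxy] := convex_norm_gap x y.
have k0 : 0 < 4 * (1 + c) ^+ 3 by rewrite mulr_gt0// exprn_gt0// addr_gt0.
have [cx|xc] := ltP c (`|x| + `|y|).
  rewrite ler_wpDl// -mulrA ler_peMr//.
    by rewrite divr_ge0// ?ltW// exprn_gt0.
  by rewrite mulrC ler_pdivlMr// mul1r ltW.
apply: ler_wpDr.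
  by rewrite mulr_ge0// ?divr_ge0// ?addr_ge0// ltW// exprn_gt0.
rewrite ler_pdivrMr//.
apply: (@le_trans _ _ ((x - y) ^+ 2)).
  rewrite -[leRHS]real_normK ?num_real//.
  by rewrite ler_sqr ?nnegrE// ltW.
apply: (le_trans gapxy); apply: ler_wpM2l => //.
have := convex_norm_le x; have := convex_norm_le y.
have := convex_norm_gt0 x; have := convex_norm_gt0 y.
have := normr_ge0 x; have := normr_ge0 y.
move: (convex_norm x) (convex_norm y) => p q y0 x0 q0 p0 qy px.
have pc : p <= 1 + c by lra.
have qc : q <= 1 + c by lra.
have -> : 4 * (1 + c) ^+ 3 = 2 * (1 + c) * (1 + c) * ((1 + c) + (1 + c)) by ring.
by rewrite !ler_pM// ?mulr_ge0// ?addr_ge0// ?lerD// ltW.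
Qed.

End convex_norm.

(** * Selecting a sequence that is Cauchy in probability *)

Section cauchy_selection.
Context d (T : measurableType d) (R : realType) (P : probability T R).
Local Notation integrable f := (P.-integrable setT (EFin \o f)).

Lemma integrable_convex_norm (X : T -> R) :
  integrable X -> integrable (convex_norm \o X).
Proof.
move=> Xi; apply: (@integrable_dominated _ _ _ _ _ (fun x => 1 + `|X x|)).
- apply: measurableT_comp; first exact: measurable_convex_norm.
  exact: integrable_measurable Xi.
- exact/integrable_add/integrable_normr/Xi/integrable_probability_cst.
- move=> x /=; rewrite gtr0_norm ?convex_norm_gt0// ger0_norm ?addr_ge0//.
  exact: convex_norm_le.
Qed.

(** Integrates [convex_norm_gap_bound] over the event [a < |X - Y|]; off this event the integrand on
    the right is nonnegative by convexity. *)
Lemma Rintegral_convex_norm_gap (X Y : T -> R) (a c : R) :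
  integrable X -> integrable Y -> 0 < a -> 0 < c ->
  a ^+ 2 / (4 * (1 + c) ^+ 3) * fine (P [set x | a < `|X x - Y x|]) <=
  \int[P]_x convex_norm (X x) + \int[P]_x convex_norm (Y x)
  - 2 * \int[P]_x convex_norm ((X x + Y x) / 2)
  + a ^+ 2 / (4 * (1 + c) ^+ 3) / c * (\int[P]_x `|X x| + \int[P]_x `|Y x|).
Proof.
move=> Xi Yi a0 c0.
have Xn := integrable_normr Xi; have Yn := integrable_normr Yi.
have XYm : integrable (fun x => (X x + Y x) / 2).
  under eq_fun do rewrite mulrC.
  exact/integrable_scale/integrable_add.
have Xf := integrable_convex_norm Xi; have Yf := integrable_convex_norm Yi.
have XYf := integrable_convex_norm XYm.
have mS : measurable [set x | a < `|X x - Y x|].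
  exact: (measurable_gt_dist _ Xi Yi).
set k := a ^+ 2 / _.
set S := [set x | _] in mS *.
rewrite -Rintegral_cst// -(setTI S).
rewrite -Rintegral_indicr//; last exact: integrable_probability_cst.
have k0 : 0 < k by rewrite divr_gt0 ?exprn_gt0// mulr_gt0// exprn_gt0// addr_gt0.
have gi := integrable_sub (integrable_add Xf Yf) (integrable_scale 2 XYf).
have hi := integrable_scale (k / c) (integrable_add Xn Yn).
have -> : \int[P]_x convex_norm (X x) + \int[P]_x convex_norm (Y x)
    - 2 * \int[P]_x convex_norm ((X x + Y x) / 2)
    + k / c * (\int[P]_x `|X x| + \int[P]_x `|Y x|) =
  \int[P]_x (convex_norm (X x) + convex_norm (Y x)
    - 2 * convex_norm ((X x + Y x) / 2) + k / c * (`|X x| + `|Y x|)).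
  rewrite (RintegralD _ gi hi)//.
  rewrite (RintegralB _ (integrable_add Xf Yf) (integrable_scale 2 XYf))//.
  rewrite (RintegralD _ Xf Yf)// (RintegralZl _ _ XYf)//.
  by rewrite (RintegralZl _ _ (integrable_add Xn Yn))// (RintegralD _ Xn Yn).
apply: le_Rintegral => //.
- exact/integrable_mul_indic/integrable_probability_cst.
- exact: integrable_add.
- move=> x _; rewrite indicE; case: (boolP (x \in S)) => [|_]; rewrite ?mulr1 ?mulr0.
    by rewrite inE; exact: convex_norm_gap_bound.
  rewrite addr_ge0//; first by have [] := convex_norm_gap (X x) (Y x).
  by rewrite mulr_ge0 ?addr_ge0// divr_ge0// ltW.
Qed.

(* Near-minimizers of the strictly convex functional [E sqrt(1 + X^2)] over a
   decreasing sequence of convex sets: the convexity gap at the midpoint of two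
   of them tends to 0, which controls their distance in probability. *)
Lemma cauchy_selection (C : nat -> set (T -> R)) (M : R) :
  (forall X, C 0%N X -> integrable X) ->
  (forall X, C 0%N X -> \int[P]_x `|X x| <= M) ->
  (forall n m, (n <= m)%N -> C m `<=` C n) ->
  (forall n, C n !=set0) ->
  (forall n X Y, C n X -> C n Y -> C n (fun x => (X x + Y x) / 2)) ->
  exists2 g : (T -> R)^nat, forall n, C n (g n) & cauchy_in_probability P g.
Proof.
move=> Ci CM Cdec C0 Cmid.
pose Phi X := \int[P]_x convex_norm (X x).
have Phi0 X : 0 <= Phi X.
  by apply: Rintegral_ge0 => x _; exact: ltW (convex_norm_gt0 _).
have PhiM X : C 0%N X -> Phi X <= 1 + M.
  move=> CX; apply: (@le_trans _ _ (\int[P]_x (1 + `|X x|))).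
    apply: le_Rintegral => //.
    - exact/integrable_convex_norm/Ci.
    - apply: integrable_add; first exact: integrable_probability_cst.
      exact/integrable_normr/Ci.
    - by move=> x _; exact: convex_norm_le.
  rewrite RintegralD//; last first.
  - exact/integrable_normr/Ci.
  - exact: integrable_probability_cst.
  by rewrite (_ : \int[P]_x 1 = 1) ?lerD2l ?CM// Rintegral_cst//= probability_setT mul1r.
pose s n := inf [set Phi X | X in C n].
have hi n : has_inf [set Phi X | X in C n].
  split; first by have [X CX] := C0 n; exists (Phi X), X.
  by exists 0 => _ [X _ <-].
have s_le n X : C n X -> s n <= Phi X.
  by move=> CX; apply: ge_inf; [exact: (hi n).2|exists X].
have s_nd n m : (n <= m)%N -> s n <= s m.
  move=> nm; apply: lb_le_inf; first exact: (hi m).1.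
  by move=> _ [X CX <-]; exact/s_le/(Cdec _ _ nm).
have s_ub : has_ubound (range s).
  exists (1 + M) => _ [n _ <-]; have [X CX] := C0 n.
  by apply: (le_trans (s_le _ _ CX)); exact/PhiM/(Cdec 0%N n).
have M0 : 0 <= M.
  have [X CX] := C0 0%N; apply: le_trans (CM _ CX).
  by apply: Rintegral_ge0.
have /choice[g gP] : forall n, exists X, C n X /\ Phi X < s n + n.+1%:R^-1.
  move=> n; have n0 : (0 : R) < n.+1%:R^-1 by rewrite invr_gt0.
  have [_ [X CX <-] XP] := inf_adherent n0 (hi n).
  by exists X.
exists g => [n|a a0]; first by have [] := gP n.
apply/cvge0_oo2P => // e e0 /=.
(* At this truncation level the correction term is at most [k * e / 2], as two L^1 norms add up to
   at most [2 * M]. *)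
pose c := 4 * (M + 1) / e.
have c0 : 0 < c by rewrite divr_gt0// mulr_gt0// ltr_wpDl.
pose k := a ^+ 2 / (4 * (1 + c) ^+ 3).
have k0 : 0 < k by rewrite divr_gt0 ?exprn_gt0// mulr_gt0// exprn_gt0// addr_gt0.
have h0 : 0 < k * e / 8 by rewrite divr_gt0// mulr_gt0.
have [_ [N1 _ <-] N1P] := sup_adherent h0 (conj (ex_intro _ (s 0%N) (ex_intro2 _ _ 0%N I erefl)) s_ub).
pose N2 := Num.truncn (k * e / 8)^-1.
have N2P : N2.+1%:R^-1 < k * e / 8.
  by rewrite invf_plt ?posrE// truncnS_gt.
exists (maxn N1 N2) => n m; rewrite !geq_max => /andP[N1n N2n] /andP[N1m N2m].
(* Two errors below [k * e / 8] add up here: the distance from [s N1] to the supremum of [s], and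
   the slack in the choice of [g j]. *)
have near_min j : (N1 <= j)%N -> (N2 <= j)%N -> Phi (g j) <= s N1 + k * e / 4.
  move=> N1j N2j; apply: (le_trans (ltW (gP j).2)).
  have : s j <= sup (range s) by apply: ub_le_sup => //; exists j.
  have : j.+1%:R^-1 <= N2.+1%:R^-1 :> R by rewrite lef_pV2 ?posrE// ler_nat.
  move: N1P N2P.
  move: (sup _) (s j) (s N1) (j.+1%:R^-1) (N2.+1%:R^-1) (k * e) => u v w y z t.
  lra.
have Cg j : C 0%N (g j) by apply: (Cdec 0%N j) => //; exact: (gP j).1.
have := Rintegral_convex_norm_gap (Ci _ (Cg n)) (Ci _ (Cg m)) a0 c0.
rewrite -/k -/(Phi (g n)) -/(Phi (g m)) -/(Phi (fun x => (g n x + g m x) / 2)).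
have := near_min _ N1n N2n; have := near_min _ N1m N2m.
(* The midpoint of [g n] and [g m] stays in [C N1], so with [near_min] the convexity gap is at most
   [k * e / 2]. *)
have : s N1 <= Phi (fun x => (g n x + g m x) / 2).
  by apply/s_le/Cmid; [exact: (Cdec _ _ N1n _ (gP n).1)|exact: (Cdec _ _ N1m _ (gP m).1)].
have : k / c * (\int[P]_x `|g n x| + \int[P]_x `|g m x|) <= k * e / 2.
  have IJ := lerD (CM _ (Cg n)) (CM _ (Cg m)).
  have -> : k / c = k * e / (4 * (M + 1)) by rewrite /c; field; rewrite !gt_eqF// ltr_wpDl.
  rewrite mulrAC ler_pdivrMr; last by lra.
  have ke0 : 0 < k * e by exact: mulr_gt0.
  by move: IJ; nra.
move=> h1 h2 h3 h4 h5.
have : k * fine (P [set x | a < `|g n x - g m x|]) <= k * e by lra.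
rewrite ler_pM2l// -lee_fin fineK//.
apply: fin_num_measure.
exact/measurable_gt_dist/(Ci _ (Cg m))/(Ci _ (Cg n)).
Qed.
End cauchy_selection.

(** * Uniform integrability as uniform absolute continuity *)

Section equi_integrable.
Context d (T : measurableType d) (R : realType).
Implicit Types (P : probability T R) (K : set (T -> R)) (A B S : set T).

(** For L^1-bounded families this amounts to uniform integrability of the restrictions to [B], see
    [uniformly_integrable_mul_indicP]. Unlike the tail condition, it speaks of all small sets, and
    so combines easily over unions. *)
Definition equi_integrable_on P K B := forall e : R, 0 < e ->
  exists2 r : R, 0 < r & forall X, K X -> forall S, measurable S ->
    (P S < r%:E)%E -> \int[P]_(x in B `&` S) `|X x| <= e.

Lemma equi_integrable_onU P K A B : measurable A -> measurable B ->
  (forall X, K X -> P.-integrable setT (EFin \o X)) ->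
  equi_integrable_on P K A -> equi_integrable_on P K B ->
  equi_integrable_on P K (A `|` B).
Proof.
move=> mA mB Ki HA HB e e0.
have e20 : 0 < e / 2 by rewrite divr_gt0.
have [r r0 HrA] := HA _ e20; have [t t0 HtB] := HB _ e20.
exists (Num.min r t); first by rewrite lt_min r0 t0.
move=> X KX S mS; rewrite EFin_min lt_min => /andP[Sr St].
have Xn := integrable_normr (Ki _ KX).
have -> : (A `|` B) `&` S = (A `&` S) `|` ((B `\` A) `&` S).
  by apply/seteqP; split => x /=; have [] := pselect (A x); tauto.
rewrite Rintegral_setU//.
- have := HrA _ KX _ mS Sr; have := HtB _ KX _ mS St.
  have : \int[P]_(x in (B `\` A) `&` S) `|X x| <= \int[P]_(x in B `&` S) `|X x|.
    apply: RintegralS => //.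
    - by apply: measurableI => //; exact: measurableD.
    - exact: measurableI.
    - by apply: setSI => x [].
  lra.
- exact: measurableI.
- by apply: measurableI => //; exact: measurableD.
- apply: integrable_setS => //; apply: measurableU; first exact: measurableI.
  by apply: measurableI => //; exact: measurableD.
- apply/disj_setPS => x [[/= Ax _] [[_ nAx] _]]; exact: nAx.
Qed.

Lemma equi_integrable_on_bigsetU P K (B : (set T)^nat) n :
  (forall k, measurable (B k)) ->
  (forall X, K X -> P.-integrable setT (EFin \o X)) ->
  (forall k, equi_integrable_on P K (B k)) ->
  equi_integrable_on P K (\big[setU/set0]_(k < n) B k).
Proof.
move=> mB Ki eB; elim: n => [|n IH].
  move=> e e0; exists 1 => // X _ S _ _.
  by rewrite big_ord0 set0I Rintegral_set0 ltW.
rewrite big_ord_recr; apply: equi_integrable_onU => //.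
exact: bigsetU_measurable.
Qed.

(** [|X|] is dominated by [c + |X| 1_{|X| > c}], for a positive [c] at which the tail expectation is
    at most 1. *)
Lemma uniformly_integrable_integrable P K X : uniformly_integrable P K -> K X ->
  P.-integrable setT (EFin \o X).
Proof.
move=> [mK UI] KX; have mX := mK _ KX.
have [c [/(_ _ KX) EX c0]] := @filter_ex _ (pinfty_nbhs R) _ _
  (filterI (UI _ ltr01) (nbhs_pinfty_gt (num_real (0 : R)))).
have mS := measurable_gt_norm c mX.
have tail_i : P.-integrable setT
    (EFin \o (fun x => `|X x| * \1_[set y | c < `|X y|] x)).
  apply/integrableP; split.
    apply/measurable_EFinP/measurable_funM => //.
    exact: measurableT_comp.
  rewrite (le_lt_trans _ (le_lt_trans EX (ltry 1)))// unlock.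
  under eq_integral => x _ do
    rewrite /= ger0_norm ?mulr_ge0// ?indicE ?ler0n// -?indicE.
  by [].
apply: (integrable_dominated mX
  (integrable_add (integrable_probability_cst P c) tail_i)) => x.
rewrite /cst (@ger0_norm _ (_ + _)); last first.
  by rewrite addr_ge0 ?(ltW c0)// mulr_ge0// indicE ler0n.
rewrite indicE; have [_|nS] := boolP (x \in _); first by rewrite mulr1 lerDr ltW.
by rewrite mulr0 addr0 leNgt; apply: contra nS => cX; rewrite inE.
Qed.

(** On [S] the same splitting of [|X|] at a level [c] costs at most [c * P S] plus the tail; each is
    made at most [e / 2]. *)
Lemma uniformly_integrable_equi P K : uniformly_integrable P K ->
  equi_integrable_on P K setT.
Proof.
move=> UIK e e0; have Ki X := @uniformly_integrable_integrable _ _ X UIK.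
have e20 : 0 < e / 2 by rewrite divr_gt0.
have [c [EX c0]] := @filter_ex _ (pinfty_nbhs R) _ _
  (filterI (UIK.2 _ e20) (nbhs_pinfty_gt (num_real (0 : R)))).
have c20 : 0 < 2 * c by rewrite mulr_gt0.
exists (e / (2 * c)); first by rewrite divr_gt0.
move=> X KX S mS PS; rewrite setTI.
have Xn := integrable_normr (Ki _ KX).
have mC := measurable_gt_norm c (UIK.1 _ KX).
have := EX _ KX; rewrite expectation_indicE// lee_fin => tail.
have tail_i := integrable_mul_indic mC Xn.
have PSf : fine (P S) < e / (2 * c).
  by rewrite -lte_fin fineK// fin_num_measure.
apply: (@le_trans _ _
    (\int[P]_(x in S) (c + `|X x| * \1_[set y | c < `|X y|] x))).
  apply: le_Rintegral => //.
  - exact: integrable_setS.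
  - apply: integrable_setS => //; apply: integrable_add => //.
    exact: integrable_probability_cst.
  - move=> x _; rewrite indicE; have [_|nS] := boolP (x \in _).
      by rewrite mulr1 lerDr ltW.
    by rewrite mulr0 addr0 leNgt; apply: contra nS => cX; rewrite inE.
rewrite RintegralD//; last 2 first.
- exact/integrable_setS/integrable_probability_cst.
- exact: integrable_setS.
rewrite Rintegral_cst// Rintegral_indicr//.
have : c * fine (P S) <= e / 2.
  rewrite -ler_pdivlMl//; apply: (le_trans (ltW PSf)).
  by rewrite le_eqVlt; apply/orP; left; apply/eqP; field; rewrite gt_eqF.
have : \int[P]_(x in S `&` [set y | c < `|X y|]) `|X x| <=
  \int[P]_(x in [set y | c < `|X y|]) `|X x|.
  by apply: RintegralS => //; exact: measurableI.
lra.
Qed.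

Lemma norm_mul_indic (X : T -> R) B x : `|(X \* \1_B) x| = `|X x| * \1_B x.
Proof. by rewrite /= normrM indicE; case: (_ \in _); rewrite ?normr1 ?normr0. Qed.

(** From right to left, the L^1 bound and Markov's inequality make the events [c < |X 1_B|]
    uniformly small for large [c]. *)
Lemma uniformly_integrable_mul_indicP P K B (M : R) : measurable B ->
  (forall X, K X -> P.-integrable setT (EFin \o X)) ->
  (forall X, K X -> \int[P]_x `|X x| <= M) ->
  uniformly_integrable P [set (X \* \1_B) | X in K] <-> equi_integrable_on P K B.
Proof.
move=> mB Ki KM; split.
  move=> /uniformly_integrable_equi H e /H[r r0 {}H]; exists r => // X KX S mS PS.
  have := H (X \* \1_B) (ex_intro2 _ _ _ KX erefl) _ mS PS.
  rewrite setTI; under eq_Rintegral => x _ do rewrite norm_mul_indic.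
  by rewrite Rintegral_indicr//; [rewrite setIC|exact/integrable_normr/Ki].
move=> H; split=> [_ [X KX <-]|e /H[r r0 {}H]].
  by apply: measurable_funM => //; exact/integrable_measurable/Ki.
have M0 : 0 <= Num.max M 0 by rewrite le_max lexx orbT.
(* [M] may be negative when [K] is empty; the maximum keeps the threshold positive. *)
exists ((Num.max M 0 + 1) / r); split; first exact: num_real.
move=> c cr _ [X KX <-].
have c0 : 0 < c by apply: le_lt_trans cr; rewrite divr_ge0 ?addr_ge0// ltW.
have Xi := Ki _ KX; have Xn := integrable_normr Xi.
have XBi := integrable_mul_indic mB Xi.
have mC := measurable_gt_norm c (integrable_measurable XBi).
rewrite expectation_indicE//; last exact: integrable_normr.
rewrite lee_fin; under eq_Rintegral => x _ do rewrite norm_mul_indic.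
rewrite Rintegral_indicr// setIC; apply: H => //.
rewrite -(@fineK _ (P _)) ?fin_num_measure// lte_fin.
apply: (le_lt_trans (markov_Rintegral c0 XBi)).
rewrite ltr_pdivrMr//.
apply: (@le_lt_trans _ _ (Num.max M 0)).
  rewrite le_max; apply/orP; left; apply: le_trans (KM _ KX).
  apply: le_Rintegral => //; first exact: integrable_normr.
  move=> x _; by rewrite norm_mul_indic ler_piMr// indicE; case: (x \in B).
by move: cr; rewrite ltr_pdivrMr//; lra.
Qed.

End equi_integrable.

(** A comparison used both for the probabilities of tails of sets and for geometric weights: partial
    sums are at most [r N - r n <= r N]. *)
Lemma nneseries_telescope_le (R : realType) (u : (\bar R)^nat) (r : R^nat) N :
  (forall n, 0 <= u n)%E -> (forall n, 0 <= r n) ->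
  (forall n, u n <= (r n - r n.+1)%:E)%E ->
  (\sum_(N <= n <oo) u n <= (r N)%:E)%E.
Proof.
move=> u0 r0 ur; apply: lime_le; first by apply: is_cvg_nneseries.
exists N => // n /= Nn; apply: (@le_trans _ _ (r N - r n)%:E); last first.
  by rewrite lee_fin gerBl.
rewrite -[(r N - r n)]opprB -telescope_sumr// -sumrN -sumEFin.
by apply: lee_sum => k _; rewrite opprB.
Qed.

(** * Tails of a sequence of sets *)

Section tails.
Context d (T : measurableType d) (R : realType) (P : probability T R).
Variables (S : (set T)^nat) (mS : forall n, measurable (S n)).

Definition tail n := \bigcup_(k in [set k | (n <= k)%N]) S k.

Lemma measurable_tail n : measurable (tail n).
Proof. by apply: bigcup_measurable. Qed.

Lemma sub_tail n k : (n <= k)%N -> S k `<=` tail n.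
Proof. by move=> nk x Skx; exists k. Qed.

Lemma measure_tail_le (r : R^nat) n : (forall k, 0 <= r k) ->
  (forall k, P (S k) <= (r k - r k.+1)%:E)%E -> (P (tail n) <= (r n)%:E)%E.
Proof.
move=> r0 Sr; apply: (@le_trans _ _ (\sum_(n <= k <oo) P (S k))%E).
  apply: measure_sigma_subadditive_tail => //; first exact: measurable_tail.
  by rewrite setC_I.
exact: nneseries_telescope_le.
Qed.

End tails.

(** * Concentration of mass on small sets *)

Section non_equi_integrable.
Context d (T : measurableType d) (R : realType) (P : probability T R).
Variables (K : set (T -> R)) (B : set T) (M : R).
Hypotheses (mB : measurable B)
  (Ki : forall X, K X -> P.-integrable setT (EFin \o X))
  (KM : forall X, K X -> \int[P]_x `|X x| <= M).

Lemma Rintegral_norm_le X A : K X -> measurable A ->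
  \int[P]_(x in A) `|X x| <= M.
Proof.
move=> KX mA; apply: le_trans (KM KX).
by apply: RintegralS => //; exact/integrable_normr/Ki.
Qed.

(* [eta] is the modulus of non-uniform integrability of [K] on [B]: the limit
   as [r] tends to 0 of the supremum of the masses [K] puts on the sets of
   probability less than [r]. *)
Lemma concentration_modulus : ~ equi_integrable_on P K B ->
  exists2 eta : R, 0 < eta &
    (exists2 r : R, 0 < r & forall X S, K X -> measurable S -> (P S < r%:E)%E ->
      \int[P]_(x in B `&` S) `|X x| <= 11 / 10 * eta) /\
    (forall r : R, 0 < r -> exists X S, [/\ K X, measurable S, (P S < r%:E)%E &
      9 / 10 * eta <= \int[P]_(x in B `&` S) `|X x|]).
Proof.
(* [V] holds the masses reached on arbitrarily small sets. The failure of equi-integrability puts a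
   positive number in it, and [M] bounds it, so [eta] is its supremum. *)
pose V := [set v : R | forall r : R, 0 < r -> exists X S, [/\ K X, measurable S,
  (P S < r%:E)%E & v <= \int[P]_(x in B `&` S) `|X x|]].
move=> /existsNP[e /not_implyP[e0 He]].
have Ve : V e.
  move=> r r0; apply: contrapT => H; apply: He; exists r => // X KX S mS Sr.
  rewrite leNgt; apply/negP => eX; apply: H; exists X, S; split => //.
  exact: ltW.
have V_ub : has_ubound V.
  exists M => v /(_ 1 ltr01)[X [S [KX mS _ /le_trans]]]; apply.
  by apply: Rintegral_norm_le => //; exact: measurableI.
have V_sup : has_sup V by split => //; exists e.
have eta0 : 0 < sup V by apply: (lt_le_trans e0); exact: ub_le_sup.
exists (sup V) => //; split.
  (* A level above the supremum is missed at some [r], and this [r] gives the uniform upper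
     bound. *)
  have : ~ V (11 / 10 * sup V).
    by move=> /(ub_le_sup V_ub); apply/negP; rewrite -ltNge; lra.
  move=> /existsNP[r /not_implyP[r0 Hr]]; exists r => // X S KX mS Sr.
  rewrite leNgt; apply/negP => /ltW ltX; apply: Hr; by exists X, S.
move=> r r0; have h0 : 0 < sup V / 10 by rewrite divr_gt0.
have [v Vv hv] := sup_adherent h0 V_sup.
have [X [S [KX mS Sr vX]]] := Vv _ r0.
by exists X, S; split => //; apply: le_trans vX; lra.
Qed.

(** Recursion on [r n]: first [X n] and [S n] are chosen with [P (S n) < r n / 2], then
    [r n.+1 <= r n / 2] so small that [X n] has little mass on any set of probability at most
    [r n.+1]. The bound [r n - r n.+1] on [P (S n)] telescopes, so the union of the later sets is
    such a set. *)
Lemma concentrating_sequence : ~ equi_integrable_on P K B ->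
  exists (eta : R) (r : R^nat) (X : (T -> R)^nat) (S : (set T)^nat),
  [/\ 0 < eta, (forall n, 0 < r n), (forall n, r n.+1 <= r n / 2),
    (forall A Y, K Y -> measurable A -> (P A <= (r 0%N)%:E)%E ->
      \int[P]_(x in B `&` A) `|Y x| <= 11 / 10 * eta) &
    forall n, [/\ K (X n), measurable (S n), (P (S n) <= (r n - r n.+1)%:E)%E,
      9 / 10 * eta <= \int[P]_(x in B `&` S n) `|X n x| &
      forall A, measurable A -> (P A <= (r n.+1)%:E)%E ->
        \int[P]_(x in A) `|X n x| <= eta / 10]].
Proof.
move=> /concentration_modulus[eta eta0 [[r0 r00 Hr0] Heta]].
have step (r : R) : exists XSr : (T -> R) * set T * R, 0 < r ->
    [/\ K XSr.1.1, measurable XSr.1.2, (P XSr.1.2 < (r / 2)%:E)%E,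
      9 / 10 * eta <= \int[P]_(x in B `&` XSr.1.2) `|XSr.1.1 x| &
      [/\ 0 < XSr.2, XSr.2 <= r / 2 &
      forall A, measurable A -> (P A <= XSr.2%:E)%E ->
        \int[P]_(x in A) `|XSr.1.1 x| <= eta / 10]].
  (* The triple for nonpositive [r] is a dummy that makes the choice function total; the iteration
     only meets positive values. *)
  have [rpos|_] := ltP 0 r; last by exists (cst 0, set0, 0).
  have r20 : 0 < r / 2 by rewrite divr_gt0.
  have [X [S [KX mS Sr SX]]] := Heta _ r20.
  have eta10 : 0 < eta / 10 by rewrite divr_gt0.
  have [t t0 Ht] := integrable_small_sets (Ki KX) eta10.
  (* Halving [t] makes room for the non-strict inequality [P A <= r n.+1]; the start of the
     iteration at [r0 / 2] has the same purpose. *)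
  exists (X, S, Num.min (r / 2) (t / 2)) => _; split => //=; split => //.
  - by rewrite lt_min r20 divr_gt0.
  - by rewrite ge_min lexx.
  - move=> A mA PA; apply: Ht => //; apply: (le_lt_trans PA).
    by rewrite lte_fin gt_min; apply/orP; right; lra.
have /choice[F FP] := step.
pose r n := iter n (fun t => (F t).2) (r0 / 2).
have rpos n : 0 < r n.
  elim: n => [|n IH]; first by rewrite /r /= divr_gt0.
  by have [_ _ _ _ []] := FP _ IH.
have rhalf n : r n.+1 <= r n / 2 by have [_ _ _ _ []] := FP _ (rpos n).
exists eta, r, (fun n => (F (r n)).1.1), (fun n => (F (r n)).1.2); split => //.
  move=> A Y KY mA PA; apply: Hr0 => //; apply: (le_lt_trans PA).
  by rewrite lte_fin /r /=; lra.
move=> n; have [? ? Sr ? [_ _ ?]] := FP _ (rpos n); split => //.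
by apply/ltW/(lt_le_trans Sr); rewrite lee_fin; have := rhalf n; lra.
Qed.

End non_equi_integrable.

(** * From L^1 convergence of Cauchy sequences to equi-integrability *)

Section cauchy_to_equi_integrable.
Context d (T : measurableType d) (R : realType) (P : probability T R).
Variables (K : set (T -> R)) (B : set T) (M : R).
Hypotheses (mB : measurable B)
  (Ki : forall X, K X -> P.-integrable setT (EFin \o X))
  (KM : forall X, K X -> \int[P]_x `|X x| <= M)
  (Kmid : forall X Y, K X -> K Y -> K (fun x => (X x + Y x) / 2)).

Section sign.
Variables (X : (T -> R)^nat) (S : (set T)^nat).
Hypotheses (mS : forall n, measurable (S n)) (KX : forall n, K (X n)).

Let D k := S k `\` tail S k.+1.
Let E := \bigcup_k (D k `&` [set x | 0 <= X k x]).

(* On [D k], where [k] is the last index with [x \in S k], this is the sign of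
   [X k]; being common to all [k], it turns the lower bounds on the masses into
   a condition which is stable under convex combinations. *)
Definition last_sign x : R := 2 * \1_E x - 1.

Lemma measurable_last_sign : measurable_fun setT last_sign.
Proof.
have mE : measurable E.
  apply: bigcup_measurable => k _; apply: measurableI.
    by apply: measurableD => //; exact: measurable_tail.
  rewrite -[X in measurable X]setTI; apply: measurable_fun_ler => //.
  exact/integrable_measurable/Ki.
by apply: measurable_funB => //; exact: measurable_funM.
Qed.

Lemma norm_last_sign x : `|last_sign x| = 1.
Proof.
rewrite /last_sign indicE; case: (x \in E) => /=.
  by rewrite mulr1 -[2]/(1 + 1) addrK normr1.
by rewrite mulr0 sub0r normrN normr1.
Qed.

(** The sets [D k] are pairwise disjoint, so on [D k] membership in [E] is decided by the sign of
    [X k] alone. *)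
Lemma last_signE k x : D k x -> X k x * last_sign x = `|X k x|.
Proof.
move=> Dkx; rewrite /last_sign indicE; have [|] := boolP (x \in E).
  rewrite inE => -[j _ [Djx Xj]]; suff <- : j = k.
    by rewrite ger0_norm//=; ring.
  case: Djx Dkx => Sj nj [Sk nk].
  case: (ltngtP j k) => // [jk|kj]; exfalso.
    by apply: nj; exists k.
  by apply: nk; exists j.
move=> nE; rewrite ler0_norm /=; first by ring.
by rewrite leNgt; apply: contra nE => X0; rewrite inE; exists k => //; split => //=; exact: ltW.
Qed.

(** On [D k] both sides equal [|X k|]; elsewhere the left-hand side is at most [- |X k|]. *)
Lemma last_sign_ge k x :
  2 * (`|X k x| * \1_(S k) x) - 2 * (`|X k x| * \1_(tail S k.+1) x) - `|X k x| <=
  X k x * last_sign x.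
Proof.
have XsN : - `|X k x| <= X k x * last_sign x.
  rewrite lerNl (le_trans (ler_norm _))// normrN normrM norm_last_sign.
  by rewrite mulr1.
have := normr_ge0 (X k x).
rewrite !indicE; have [kS|] := boolP (x \in S k); have [kU|kU] := boolP (x \in tail _ _);
  rewrite ?mulr1 ?mulr0; move: XsN; try lra.
move=> _; rewrite last_signE; first lra.
by split; [rewrite inE in kS|move=> /mem_set; apply/negP].
Qed.

Lemma integrable_last_sign Y : K Y ->
  P.-integrable setT (EFin \o (fun x => Y x * last_sign x)).
Proof.
move=> KY; apply: (integrable_dominated _ (Ki KY)).
  by apply: measurable_funM; [exact/integrable_measurable/Ki|exact: measurable_last_sign].
by move=> x; rewrite normrM norm_last_sign mulr1.
Qed.

(** Integrates [last_sign_ge] over [B] and [tail S n]. As [S k] lies in this tail, the first term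
    keeps the whole mass of [X k] on [S k]. *)
Lemma Rintegral_last_sign_ge n k : (n <= k)%N ->
  2 * \int[P]_(x in B `&` S k) `|X k x|
  - 2 * \int[P]_(x in tail S k.+1) `|X k x|
  - \int[P]_(x in B `&` tail S n) `|X k x| <=
  \int[P]_(x in B `&` tail S n) (X k x * last_sign x).
Proof.
move=> nk; have mU j : measurable (tail S j) by exact: measurable_tail.
have mBU : measurable (B `&` tail S n) by exact: measurableI.
have Xn := integrable_normr (Ki (KX k)).
have XS := integrable_mul_indic (mS k) Xn.
have XU := integrable_mul_indic (mU k.+1) Xn.
have XSU := integrable_sub (integrable_scale 2 XS) (integrable_scale 2 XU).
apply: (@le_trans _ _ (\int[P]_(x in B `&` tail S n)
  (2 * (`|X k x| * \1_(S k) x) - 2 * (`|X k x| * \1_(tail S k.+1) x) - `|X k x|))).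
  rewrite RintegralB//; [|exact: integrable_setS..].
  rewrite RintegralB//; [|by apply: integrable_setS => //; exact: integrable_scale..].
  rewrite !RintegralZl//; [|exact: integrable_setS..].
  rewrite !Rintegral_indicr//.
  rewrite -setIA (setIidr (sub_tail nk)) lerD2r lerD2l lerN2 ler_pM2l//.
  by apply: RintegralS => //; exact: measurableI.
apply: le_Rintegral => //.
- by apply: integrable_setS => //; exact: integrable_sub.
- by apply: integrable_setS => //; exact: integrable_last_sign.
- by move=> x _; exact: last_sign_ge.
Qed.

End sign.

Lemma equi_integrable_of_cauchy :
  (forall X : (T -> R)^nat, (forall n, K (X n)) ->
    cauchy_in_probability P X -> cauchy_in_L1_on P B X) ->
  equi_integrable_on P K B.
Proof.
move=> KL1; apply: contrapT => /(concentrating_sequence mB Ki KM).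
move=> [eta [r [X [S [eta0 r0 rhalf Hr0 HX]]]]].
have KX n : K (X n) by have [] := HX n.
have mS n : measurable (S n) by have [] := HX n.
have mU n : measurable (tail S n) by exact: measurable_tail.
have mBU n : measurable (B `&` tail S n) by exact: measurableI.
have PU n : (P (tail S n) <= (r n)%:E)%E.
  by apply: measure_tail_le => // k; [exact: ltW|have [] := HX k].
have r_noninc n : r n <= r 0%N.
  elim: n => // n IH; apply: (le_trans (rhalf n)).
  by have := r0 n; move: IH; lra.
(* Since [n + 2 <= 2 * (n + 1)], halving keeps the product from growing; this crude rate already
   gives [r n] tending to 0. *)
have r_lim n : r n * n.+1%:R <= r 0%N.
  elim: n => [|n IH]; first by rewrite mulr1.
  apply: le_trans IH; have := rhalf n; have := r0 n.
  rewrite -[n.+2%:R]natr1 -[n.+1%:R]natr1; have : (0 : R) <= n%:R by [].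
  move: (n%:R) (r n) (r n.+1) => x y z x0 y0 zy.
  have := ler_wpM2r (_ : 0 <= x + 1 + 1) zy; have := mulr_ge0 x0 (ltW y0).
  by nra.
pose sg := last_sign X S.
(* Imposing the bound for all [m <= n] makes [C] decreasing; linearity in [g] makes it stable under
   midpoints. *)
pose C n := [set g | K g /\ forall m, (m <= n)%N ->
  eta / 2 <= \int[P]_(x in B `&` tail S m) (g x * sg x)].
(* The constants fit: [2 * 9/10 - 2 * 1/10 - 11/10 = 1/2]. *)
have CX n : C n (X n).
  split=> // m mn; have := Rintegral_last_sign_ge mS KX mn.
  have [_ _ _ XS Xsmall] := HX n.
  have := Xsmall _ (mU n.+1) (PU n.+1).
  have : \int[P]_(x in B `&` tail S m) `|X n x| <= 11 / 10 * eta.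
    by apply: Hr0 => //; apply: (le_trans (PU m)); rewrite lee_fin.
  by move: XS; rewrite -/sg; lra.
have [g Cg gP] : exists2 g : (T -> R)^nat, forall n, C n (g n) &
    cauchy_in_probability P g.
  apply: (@cauchy_selection _ _ _ _ C M).
  - by move=> Y [KY _]; exact: Ki.
  - by move=> Y [KY _]; exact: KM.
  - by move=> n m nm Y [KY YP]; split => // k kn; exact/YP/(leq_trans kn).
  - by move=> n; exists (X n).
  - move=> n Y Z [KY YP] [KZ ZP]; split=> [|m mn]; first exact: Kmid.
    have Yi := integrable_last_sign mS KX KY.
    have Zi := integrable_last_sign mS KX KZ.
    rewrite (_ : (fun x => (Y x + Z x) / 2 * sg x) =
      (fun x => 2^-1 * (Y x * sg x + Z x * sg x))); last first.
      by apply/funext => x; ring.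
    rewrite RintegralZl//; last by apply: integrable_setS => //; exact: integrable_add.
    rewrite RintegralD//; [|exact: integrable_setS..].
    by have := YP _ mn; have := ZP _ mn; lra.
have Kg n : K (g n) by have [] := Cg n.
have eta80 : 0 < eta / 8 by rewrite divr_gt0.
have gi n m : P.-integrable setT (EFin \o (fun x => `|g n x - g m x|)).
  exact/integrable_normr/integrable_sub/Ki/Kg/Ki/Kg.
have [N HN] : exists N : nat, forall n m : nat, (N <= n)%N -> (N <= m)%N ->
    \int[P]_(x in B) `|g n x - g m x| <= eta / 8.
  have E0 nm : (0 <= 'E_P[fun x => (`|g nm.1 x - g nm.2 x| * \1_B x)%R])%E.
    by rewrite expectation_indicE// lee_fin; exact: Rintegral_ge0.
  have [N HN] := (cvge0_oo2P E0).1 (KL1 g Kg gP) _ eta80.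
  exists N => n m Nn Nm; have := HN _ _ Nn Nm.
  by rewrite expectation_indicE// lee_fin.
(* [N] is now fixed, so the single function [g N] has mass at most [eta / 8] on late tails. As [g n]
   is within [eta / 8] of [g N] in L^1 on [B], its signed mass there is at most [eta / 4], against
   the lower bound [eta / 2]. *)
have [t t0 Ht] := integrable_small_sets (Ki (Kg N)) eta80.
pose n := maxn N (Num.truncn (r 0%N / t)).
have rt : r n < t.
  rewrite -(ltr_pM2r (_ : 0 < n.+1%:R))//; apply: (le_lt_trans (r_lim n)).
  rewrite mulrC -ltr_pdivrMr//; apply: (lt_le_trans (truncnS_gt _)).
  by rewrite ler_nat ltnS leq_maxr.
have : \int[P]_(x in B `&` tail S n) (g n x * sg x) <=
    \int[P]_(x in B) `|g n x - g N x| + \int[P]_(x in tail S n) `|g N x|.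
  apply: (@le_trans _ _ (\int[P]_(x in B `&` tail S n)
      (`|g n x - g N x| + `|g N x|))).
    apply: le_Rintegral => //.
    - by apply: integrable_setS => //; exact: integrable_last_sign.
    - by apply: integrable_setS => //; exact/integrable_add/integrable_normr/Ki.
    - move=> x _; apply: (le_trans (ler_norm _)).
      rewrite normrM norm_last_sign mulr1 -[in leLHS](subrK (g N x) (g n x)).
      exact: ler_normD.
  have gNn := integrable_normr (Ki (Kg N)).
  rewrite RintegralD//; [|exact: integrable_setS..].
  by apply: lerD; apply: RintegralS => //; apply: integrable_normr.
have := Ht _ (mU n) (le_lt_trans (PU n) (_ : _ < _)%E).
rewrite lte_fin rt => /(_ isT).
have := HN n N (leq_maxl _ _) (leqnn _).
have [_ /(_ _ (leqnn _))] := Cg n.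
lra.
Qed.

End cauchy_to_equi_integrable.

Lemma ge0_integral_mrestr d (T : measurableType d) (R : realType)
    (m : {measure set T -> \bar R}) D (mD : measurable D) (f : T -> \bar R) :
  measurable_fun setT f -> (forall x, 0 <= f x)%E ->
  (\int[mrestr m mD]_x f x = \int[m]_(x in D) f x)%E.
Proof.
move=> mf f0.
rewrite (@ge0_negligible_integral _ _ _ (mrestr m mD) _ (~` D))//; last 2 first.
- exact: measurableC.
- by transitivity (m (~` D `&` D)) => //; rewrite setICl measure0.
rewrite setTD setCK; apply: eq_measure_integral => A mA AD.
by transitivity (m (A `&` D)) => //; rewrite setIidl.
Qed.

(** * Exhausting the space by sets of equi-integrability *)

Section exhaustion.
Context d (T : measurableType d) (R : realType) (P : probability T R).
Variables (K : set (T -> R)).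
Hypothesis Ki : forall X, K X -> P.-integrable setT (EFin \o X).

(** The probabilities of the [B n] approach the supremum over all sets of equi-integrability. A
    non-null complement of their union would contain such a set [A], and adding it to some [B n]
    would exceed the supremum. *)
Lemma equi_integrable_exhaustion :
  (forall A, measurable A -> (0 < P A)%E -> exists B, [/\ measurable B, B `<=` A,
    (0 < P B)%E & equi_integrable_on P K B]) ->
  exists B : (set T)^nat, [/\ forall n, measurable (B n),
    forall n, equi_integrable_on P K (B n) & P (~` \bigcup_n B n) = 0%E].
Proof.
move=> H.
pose V := [set fine (P B) | B in [set B | measurable B /\ equi_integrable_on P K B]].
have V0 : V !=set0.
  have [|B [mB _ _ eB]] := H setT measurableT; first by rewrite probability_setT.
  by exists (fine (P B)), B.
have V_ub : has_ubound V.
  exists 1 => _ [B [mB _] <-]; rewrite -lee_fin fineK ?fin_num_measure//.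
  exact: probability_le1.
have /choice[B BP] : forall n, exists B, [/\ measurable B,
    equi_integrable_on P K B & sup V - n.+1%:R^-1 < fine (P B)].
  move=> n; have n0 : (0 : R) < n.+1%:R^-1 by rewrite invr_gt0.
  by have [_ [B [mB eB] <-] ?] := sup_adherent n0 (conj V0 V_ub); exists B.
have mB n : measurable (B n) by have [] := BP n.
have mC : measurable (~` \bigcup_n B n).
  exact/measurableC/bigcup_measurable.
exists B; split => // [n|]; first by have [] := BP n.
apply/eqP; rewrite eq_le measure_ge0 andbT leNgt; apply/negP => /(H _ mC).
move=> [A [mA AB PA0 eA]].
have PA0' : 0 < fine (P A) by rewrite fine_gt0// PA0 ltey_eq fin_num_measure.
pose n := Num.truncn (fine (P A))^-1.
have nA : n.+1%:R^-1 < fine (P A) by rewrite invf_plt ?posrE// truncnS_gt.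
have [_ eB nB] := BP n.
have : fine (P (B n `|` A)) <= sup V.
  apply: ub_le_sup => //; exists (B n `|` A) => //; split.
    exact: measurableU.
  exact: equi_integrable_onU.
rewrite measureU//; last first.
  apply/seteqP; split => // x [Bx /AB]; apply; by exists n.
rewrite fineD ?fin_num_measure//.
by move: nB nA; move: (fine _) (fine _) (_^-1) (sup V) => a b c s; lra.
Qed.

End exhaustion.

(** * The equivalent probability measure *)

Section mixture.
Context d (T : measurableType d) (R : realType) (P : probability T R).
Variables (B : (set T)^nat) (mB : forall n, measurable (B n)).
Hypothesis PB : P (~` \bigcup_n B n) = 0%E.

(** With respect to [P] its density is the sum of [2^-(n+1) 1_(B n)], which is at most 1 and, by
    [PB], almost everywhere positive. *)
Definition mixture : {measure set T -> \bar R} :=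
  mseries (fun n => mscale ((2^-1 ^+ n.+1)%:nng : {nonneg R}) (mrestr P (mB n))) 0.

Let half_gt0 n : 0 < (2^-1 ^+ n : R).
Proof. by rewrite exprn_gt0// invr_gt0. Qed.

Let half_ge0 n : 0 <= (2^-1 ^+ n : R).
Proof. exact: ltW. Qed.

Let half_step n : (2^-1 ^+ n.+1 : R) = 2^-1 ^+ n - 2^-1 ^+ n.+1.
Proof. by rewrite exprS; have := half_gt0 n; lra. Qed.

Lemma mixtureE A :
  mixture A = (\sum_(0 <= n <oo) (2^-1 ^+ n.+1)%:E * P (A `&` B n))%E.
Proof. by []. Qed.

(** The weights are positive, so a null set for the mixture meets each [B n] in a [P]-null set, and
    what lies outside all of them is null by [PB]. *)
Lemma mixture_eq0 A : measurable A -> mixture A = 0%E <-> P A = 0%E.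
Proof.
move=> mA; rewrite mixtureE; split; last first.
  move=> PA; apply: eseries0 => n _ _.
  rewrite (_ : P (A `&` B n) = 0%E) ?mule0//.
  apply/eqP; rewrite eq_le measure_ge0 andbT -PA le_measure// inE//.
  exact: measurableI.
move=> mA0.
have AB n : P (A `&` B n) = 0%E.
  apply/eqP; rewrite eq_le measure_ge0 andbT.
  rewrite -(pmule_rle0 _ (_ : 0 < (2^-1 ^+ n.+1)%:E)%E) ?lte_fin// -mA0.
  apply: (le_trans _ (nneseries_lim_ge n.+1 _)); last first.
    by move=> k _ _; rewrite mule_ge0// lee_fin.
  rewrite big_nat_recr//= leeDr// sume_ge0// => i _.
  by rewrite mule_ge0// lee_fin.
have mU : measurable (\bigcup_n B n) by exact: bigcup_measurable.
apply/eqP; rewrite eq_le measure_ge0 andbT.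
have -> : A = (A `&` \bigcup_n B n) `|` (A `&` ~` \bigcup_n B n).
  by rewrite -setIUr setUv setIT.
apply: (le_trans (measureU2 _ _ _)).
- exact: measurableI.
- exact/measurableI/measurableC.
rewrite [X in (_ + X)%E](_ : _ = 0%E) ?adde0; last first.
  apply/eqP; rewrite eq_le measure_ge0 andbT -PB le_measure// inE//.
    exact/measurableI/measurableC.
  exact: measurableC.
apply: (@le_trans _ _ (\sum_(0 <= n <oo) P (A `&` B n))%E).
  apply: measure_sigma_subadditive => //.
  - by move=> n; exact: measurableI.
  - exact: measurableI.
  - by rewrite setI_bigcupr.
by rewrite eseries0.
Qed.

Lemma mixture_lty : (mixture setT < +oo)%E.
Proof.
rewrite mixtureE; apply: (le_lt_trans _ (ltry 1)).
apply: (@nneseries_telescope_le _ _ (fun n => 2^-1 ^+ n)) => // n.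
  by rewrite mule_ge0// lee_fin.
rewrite -half_step setTI -[leRHS]mule1.
by rewrite lee_pmul2l ?lte_fin// probability_le1.
Qed.

Lemma ge0_integral_mixture (f : T -> \bar R) : measurable_fun setT f ->
  (forall x, 0 <= f x)%E ->
  (\int[mixture]_x f x =
    \sum_(0 <= n <oo) (2^-1 ^+ n.+1)%:E * \int[P]_(x in B n) f x)%E.
Proof.
move=> mf f0; rewrite ge0_integral_measure_series//.
apply: eq_eseriesr => n _; rewrite ge0_integral_mscale//.
by rewrite ge0_integral_mrestr.
Qed.

(** The second argument of [mnormalize] is its value at total mass zero or infinity;
    [mixture_probabilityE] rules out both. *)
Definition mixture_probability : probability T R := mnormalize mixture P.

Lemma mixture_probabilityE A : mixture_probability A =
  ((fine (mixture setT))^-1%:E * mixture A)%E.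
Proof.
rewrite /mixture_probability /= /mnormalize.
case: ifPn => [/orP[/eqP/(mixture_eq0 measurableT)|/eqP mT]|_].
- by rewrite probability_setT => /eqP; rewrite onee_eq0.
- by have := mixture_lty; rewrite mT.
- by rewrite muleC.
Qed.

Lemma mixture_mass_gt0 : 0 < fine (mixture setT).
Proof.
apply: fine_gt0; rewrite mixture_lty andbT lt0e measure_ge0 andbT.
apply/eqP => /(mixture_eq0 measurableT)/eqP.
by rewrite probability_setT onee_eq0.
Qed.

Lemma mixture_probability_eq0 A : measurable A ->
  mixture_probability A = 0%E <-> P A = 0%E.
Proof.
move=> mA; rewrite -mixture_eq0// mixture_probabilityE; split=> [/eqP|->].
  by rewrite mule_eq0 eqe invr_eq0 gt_eqF ?mixture_mass_gt0//= => /eqP.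
by rewrite mule0.
Qed.

Lemma ge0_integral_mixture_probability (f : T -> \bar R) :
  measurable_fun setT f -> (forall x, 0 <= f x)%E ->
  (\int[mixture_probability]_x f x =
    (fine (mixture setT))^-1%:E *
    \sum_(0 <= n <oo) (2^-1 ^+ n.+1)%:E * \int[P]_(x in B n) f x)%E.
Proof.
move=> mf f0; rewrite -ge0_integral_mixture//.
have c0 : 0 <= (fine (mixture setT))^-1 by rewrite invr_ge0 ltW// mixture_mass_gt0.
rewrite -(@ge0_integral_mscale _ _ _ _ _ _ (NngNum c0))//.
apply: eq_measure_integral => A mA _.
exact: mixture_probabilityE.
Qed.

(** The series of tail masses is cut at [N]: the first [N] terms are small by equi-integrability on
    a finite union, the others are bounded by the L^1 norm times a geometric remainder. *)
Lemma uniformly_integrable_mixture (K : set (T -> R)) (M : R) :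
  (forall X, K X -> P.-integrable setT (EFin \o X)) ->
  (forall X, K X -> \int[P]_x `|X x| <= M) ->
  (forall n, equi_integrable_on P K (B n)) ->
  uniformly_integrable mixture_probability K.
Proof.
move=> Ki KM eB; split=> [X KX|e e0]; first exact/integrable_measurable/Ki.
pose c := (fine (mixture setT))^-1.
have c0 : 0 < c by rewrite invr_gt0 mixture_mass_gt0.
pose M' := Num.max M 0.
have M'0 : 0 <= M' by rewrite le_max lexx orbT.
have KM' X A : K X -> measurable A -> \int[P]_(x in A) `|X x| <= M'.
  by move=> KX mA; rewrite le_max (Rintegral_norm_le Ki KM).
(* Each of the two pieces may cost [h], before the normalizing factor [c]. *)
pose h := e / c / 2.
have h0 : 0 < h by rewrite !divr_gt0.
pose N := Num.truncn (M' / h).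
have NP : M' * 2^-1 ^+ N <= h.
  rewrite exprVn ler_pdivrMr ?exprn_gt0// mulrC -ler_pdivrMr//.
  apply: (le_trans (ltW (truncnS_gt _))); rewrite -natrX ler_nat.
  exact: ltn_expl.
have [r r0 rP] := equi_integrable_on_bigsetU N mB Ki eB h0.
exists (M' / r); split; first exact: num_real.
move=> t tr X KX.
have t0 : 0 < t by apply: le_lt_trans tr; rewrite divr_ge0// ltW.
have Xi := Ki _ KX; have Xn := integrable_normr Xi.
have mX := integrable_measurable Xi.
set S := [set y | t < `|X y|].
have mS : measurable S by exact: measurable_gt_norm.
have Sr : (P S < r%:E)%E.
  rewrite -(@fineK _ (P S)) ?fin_num_measure// lte_fin.
  apply: (le_lt_trans (markov_Rintegral t0 Xi)).
  rewrite ltr_pdivrMr// mulrC -ltr_pdivrMr//; apply: le_lt_trans tr.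
  by rewrite ler_pM2r ?invr_gt0// KM'.
pose a n := \int[P]_(x in B n `&` S) `|X x|.
have a_small n : (n < N)%N -> a n <= h.
  move=> nN; apply: le_trans (rP _ KX _ mS Sr); apply: RintegralS => //.
  - exact: measurableI.
  - by apply: measurableI => //; exact: bigsetU_measurable.
  - by apply: setSI; exact: (bigsetU_sup nN).
have a0 n : 0 <= a n by exact: Rintegral_ge0.
have aM n : a n <= M' by apply: KM' => //; exact: measurableI.
rewrite unlock ge0_integral_mixture_probability//; last first.
  apply/measurable_EFinP/measurable_funM => //; exact: measurableT_comp.
rewrite -/c; under eq_eseriesr => n _ do
  rewrite -RintegralEFin ?Rintegral_indicr ?integrable_mul_indic// -/(a n) -EFinM.
have -> : e = c * (2 * h) by rewrite /h; field; rewrite gt_eqF.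
rewrite EFinM lee_pmul2l ?lte_fin//.
(* A telescoping majorant: step [n] drops by [h] times the weight, plus [M'] times the weight once
   [n] reaches [N]. *)
pose q n := h * 2^-1 ^+ n + M' * 2^-1 ^+ maxn n N.
apply: (@le_trans _ _ (q 0%N)%:E); last first.
  by rewrite lee_fin /q max0n expr0 mulr1; lra.
apply: nneseries_telescope_le => n.
- by rewrite lee_fin mulr_ge0.
- by rewrite addr_ge0// mulr_ge0// ltW.
- rewrite lee_fin /q opprD addrACA -!mulrBr -half_step.
  have [nN|Nn] := ltnP n N.
    rewrite (maxn_idPr nN) subrr mulr0 addr0 mulrC.
    by rewrite ler_pM2r// a_small.
  rewrite (maxn_idPl (leqW Nn)) -half_step.
  by rewrite -mulrDl mulrC ler_pM2r// (le_trans (aM n))// lerDr ltW.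
Qed.

End mixture.

(** * Absolute continuity and change of measure *)

Section absolute_continuity.
Context d (T : measurableType d) (R : realType).
Implicit Types (P Q : probability T R) (K : set (T -> R)).

Lemma null_dominates_density P Q : P `<< Q -> exists f : T -> R,
  Q.-integrable setT (EFin \o f) /\
  forall A, measurable A -> (P A = (\int[Q]_(x in A) f x)%:E)%E.
Proof.
move=> PQ; pose f := Radon_Nikodym (charge_of_finite_measure P) Q.
have PQ' : charge_of_finite_measure P `<< Q by [].
have fE : f = EFin \o (fine \o f).
  by apply/funext => x /=; rewrite fineK//; exact: Radon_Nikodym_fin_num.
have fi : Q.-integrable setT (EFin \o (fine \o f)).
  by rewrite -fE; exact: Radon_Nikodym_integrable.
exists (fine \o f); split => // A mA; rewrite RintegralEFin//.
transitivity (\int[Q]_(x in A) f x)%E; first exact: (Radon_Nikodym_integral PQ').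
by rewrite [in LHS]fE.
Qed.

(** The epsilon-delta form of absolute continuity, from integrability of the Radon-Nikodym
    density. *)
Lemma null_dominates_small_sets P Q (e : R) : P `<< Q -> 0 < e ->
  exists2 r : R, 0 < r & forall A, measurable A -> (Q A < r%:E)%E ->
    (P A <= e%:E)%E.
Proof.
move=> /null_dominates_density[f [fi PE]] e0.
have [r r0 Hr] := integrable_small_sets fi e0; exists r => // A mA Ar.
rewrite PE// lee_fin; apply: le_trans (Hr _ mA Ar).
apply: le_Rintegral => //; first exact: integrable_setS.
  exact/integrable_setS/integrable_normr.
by move=> x _; exact: ler_norm.
Qed.

(** [A] is the set where the density is at most [c] in absolute value. Markov's inequality makes its
    complement small for [Q], hence for [P]. *)
Lemma null_dominates_bounded_density P Q (e : R) : P `<< Q -> 0 < e ->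
  exists A : set T, exists2 c : R, 0 < c &
    [/\ measurable A, ((1 - e)%:E < P A)%E &
      forall B, measurable B -> (P (B `&` A) <= c%:E * Q B)%E].
Proof.
move=> PQ e0; have e20 : 0 < e / 2 by rewrite divr_gt0.
have [r r0 Hr] := null_dominates_small_sets PQ e20.
have [f [fi PE]] := null_dominates_density PQ.
pose I := \int[Q]_x `|f x|.
have I0 : 0 <= I by exact: Rintegral_ge0.
(* Adding 1 makes Markov's bound [I / c] strictly less than [r]. *)
pose c := (I + 1) / r.
have c0 : 0 < c by rewrite divr_gt0// ltr_wpDl.
pose C := [set x | c < `|f x|].
have mC : measurable C.
  exact/measurable_gt_norm/integrable_measurable/fi.
exists (~` C), c => //; split => [||B mB].
- exact: measurableC.
- have : (P C <= (e / 2)%:E)%E.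
    apply: Hr => //; rewrite -(@fineK _ (Q _)) ?fin_num_measure// lte_fin.
    apply: (le_lt_trans (markov_Rintegral c0 fi)).
    rewrite ltr_pdivrMr// /c mulrC divfK ?gt_eqF//; rewrite -/I; lra.
  rewrite probability_setC// -(@fineK _ (P _)) ?fin_num_measure//.
  by rewrite -EFinB lee_fin lte_fin; lra.
- have mBA : measurable (B `&` ~` C).
    by apply: measurableI => //; exact: measurableC.
  rewrite PE// -(@fineK _ (Q B)) ?fin_num_measure// -EFinM lee_fin.
  apply: (@le_trans _ _ (c * fine (Q (B `&` ~` C)))).
    rewrite -Rintegral_cst//; apply: le_Rintegral => //.
    - exact: integrable_setS.
    - exact/integrable_setS/integrable_probability_cst.
    - by move=> x [_ /= /negP]; rewrite -leNgt; apply: le_trans; exact: ler_norm.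
  rewrite ler_pM2l// fine_le ?fin_num_measure//.
  by rewrite le_measure ?inE//.
Qed.

(** The restriction of [P] to [A] is setwise below [c] times [Q], and integrals of nonnegative
    functions follow. *)
Lemma le_expectation_indic P Q A (c : R) (f : T -> R) : measurable A -> 0 < c ->
  (forall B, measurable B -> (P (B `&` A) <= c%:E * Q B)%E) ->
  (forall x, 0 <= f x) -> Q.-integrable setT (EFin \o f) ->
  ('E_P[fun x => (f x * \1_A x)%R] <= (c * \int[Q]_x f x)%:E)%E.
Proof.
move=> mA c0 PQ f0 fi; have mf : measurable_fun setT (EFin \o f).
  exact: measurable_int fi.
have -> : ('E_P[fun x => (f x * \1_A x)%R] = \int[P]_(x in A) (f x)%:E)%E.
  rewrite unlock [in RHS]integral_mkcond.
  by apply: eq_integral => x _; rewrite epatch_indic.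
rewrite -(ge0_integral_mrestr P mA mf)//.
rewrite EFinM RintegralEFin//.
rewrite -(@ge0_integral_mscale _ _ _ _ _ _ (NngNum (ltW c0)))//; last first.
  by move=> x _; rewrite lee_fin.
by apply: ge0_le_measure_integral.
Qed.

(** The event [e / 3 < |X n - X m|] is small for [P], hence for [Q]. Off it the difference is at
    most [e / 3]; on it [X n] and [X m] each have mass at most [e / 3]. *)
Lemma uniformly_integrable_cauchy P Q K (X : (T -> R)^nat) : Q `<< P ->
  uniformly_integrable Q K -> (forall n, K (X n)) ->
  (forall n, P.-integrable setT (EFin \o X n)) ->
  cauchy_in_probability P X ->
  forall e : R, 0 < e -> exists N : nat, forall n m, (N <= n)%N -> (N <= m)%N ->
    \int[Q]_x `|X n x - X m x| <= e.
Proof.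
move=> QP UI KX Pi Xc e e0; have e30 : 0 < e / 3 by rewrite divr_gt0.
have Xi n := uniformly_integrable_integrable UI (KX n).
have [r r0 Hr] := uniformly_integrable_equi UI e30.
have r20 : 0 < r / 2 by rewrite divr_gt0.
have [t t0 Ht] := null_dominates_small_sets QP r20.
have t20 : 0 < t / 2 by rewrite divr_gt0.
pose S n m := [set x | e / 3 < `|X n x - X m x|].
have [N HN] : exists N : nat, forall n m : nat, (N <= n)%N -> (N <= m)%N ->
    (P (S n m) <= (t / 2)%:E)%E.
  exact: (cvge0_oo2P (fun nm => measure_ge0 P (S nm.1 nm.2))).1 (Xc _ e30) _ t20.
exists N => n m Nn Nm.
have mS : measurable (S n m) by exact: measurable_gt_dist (Xi n) (Xi m).
have QS : (Q (S n m) < r%:E)%E.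
  apply: (@le_lt_trans _ _ (r / 2)%:E); last by rewrite lte_fin; lra.
  by apply: Ht => //; apply: (le_lt_trans (HN _ _ Nn Nm)); rewrite lte_fin; lra.
have Xn k := integrable_normr (Xi k).
have XS k := integrable_mul_indic mS (Xn k).
apply: (@le_trans _ _ (\int[Q]_x (e / 3 +
    (`|X n x| * \1_(S n m) x + `|X m x| * \1_(S n m) x)))).
  apply: le_Rintegral => //.
  - exact/integrable_normr/integrable_sub.
  - by apply: integrable_add; [exact: integrable_probability_cst|exact: integrable_add].
  - move=> x _; rewrite indicE; have [_|nS] := boolP (x \in S n m).
      by rewrite !mulr1 ler_wpDl ?ler_normB// ltW.
    by rewrite !mulr0 !addr0 leNgt; apply: contra nS => cX; rewrite inE.
rewrite RintegralD//; [|exact: integrable_probability_cst|exact: integrable_add].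
rewrite RintegralD// Rintegral_cst//= probability_setT mulr1.
rewrite !Rintegral_indicr//.
have := Hr _ (KX n) _ mS QS; have := Hr _ (KX m) _ mS QS; lra.
Qed.

Lemma cauchy_in_L1_onS P A B (X : (T -> R)^nat) :
  measurable A -> measurable B -> A `<=` B ->
  (forall n, P.-integrable setT (EFin \o X n)) ->
  cauchy_in_L1_on P B X -> cauchy_in_L1_on P A X.
Proof.
move=> mA mB AB Xi.
have Xn n m := integrable_normr (integrable_sub (Xi n) (Xi m)).
have E0 C : measurable C -> forall nm,
    (0 <= 'E_P[fun x => (`|X nm.1 x - X nm.2 x| * \1_C x)%R])%E.
  by move=> mC nm; rewrite expectation_indicE// lee_fin; exact: Rintegral_ge0.
move=> /(cvge0_oo2P (E0 B mB)) H; apply/(cvge0_oo2P (E0 A mA)) => e /H[N HN].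
exists N => n m Nn Nm; apply: le_trans (HN _ _ Nn Nm).
by rewrite !expectation_indicE// lee_fin; exact: RintegralS.
Qed.

End absolute_continuity.

(** * The cycle of implications *)

Unset Implicit Arguments.
Set Strict Implicit.
Local Open Scope ereal_scope.

Theorem proposition2p4 (d : measure_display) (T : measurableType d)
    (R : realType) (P : probability T R) (K : set (T -> R)) :
  nonatomic P ->
  (forall X, K X -> X \in Lfun P 1) ->
  convex_set (K : set (convex_lmodType (T -> R^o))) ->
  L1_bounded P K ->
  [<-> exists Q : probability T R,
         [/\ Q `<< P, P `<< Q & uniformly_integrable Q K];
       forall eps : R, (0 < eps)%R ->
         exists A : set T, [/\ measurable A, (1 - eps)%:E < P A &
           forall X : (T -> R)^nat, (forall n, K (X n)) ->
             cauchy_in_probability P X -> cauchy_in_L1_on P A X];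
       forall A : set T, measurable A -> 0 < P A ->
         exists B : set T, [/\ measurable B, B `<=` A, 0 < P B &
           forall X : (T -> R)^nat, (forall n, K (X n)) ->
             cauchy_in_probability P X -> cauchy_in_L1_on P B X];
       forall A : set T, measurable A -> 0 < P A ->
         exists B : set T, [/\ measurable B, B `<=` A, 0 < P B &
           uniformly_integrable P [set (X \* \1_B)%R | X in K]]].
Proof.
move=> _ K1 Kconv Kbd.
have Ki X : K X -> P.-integrable setT (EFin \o X) by move=> /K1/Lfun1_integrable.
have [M KM] : exists M : R, forall X, K X -> (\int[P]_x `|X x| <= M)%R.
  exists (fine (ereal_sup [set 'E_P[fun x => `|X x|%R] | X in K])) => X KX.
  have Xn := integrable_normr (Ki _ KX).
  have X_le : (\int[P]_x `|X x|)%R%:E <=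
      ereal_sup [set 'E_P[fun x => `|X x|%R] | X in K].
    by rewrite -expectationE//; apply: ereal_sup_ubound; exists X.
  rewrite -lee_fin [leRHS]fineK; first exact: X_le.
  by rewrite fin_numElt (lt_le_trans (ltNyr _) X_le) Kbd.
(* Convexity enters through midpoints, the weight being [2^-1]. *)
have Kmid X Y : K X -> K Y -> K (fun x => (X x + Y x) / 2)%R.
  move=> /mem_set KX /mem_set KY.
  have h0 : (0 <= 2^-1 :> R)%R by rewrite invr_ge0.
  have h1 : (2^-1 <= 1 :> R)%R by rewrite invf_le1// ler1n.
  have := Kconv X Y (Itv01 h0 h1) KX KY; rewrite inE.
  congr K; apply/funext => x.
  transitivity (2^-1 * X x + (1 - 2^-1) * Y x)%R; first by [].
  by field.
tfae.
- move=> [Q [QP PQ UI]] eps eps0.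
  have [A [c c0 [mA PA PAQ]]] := null_dominates_bounded_density PQ eps0.
  exists A; split => // X KX Xc.
  have Xi n := Ki _ (KX n).
  have Qi n := uniformly_integrable_integrable UI (KX n).
  have XQ n m := integrable_normr (integrable_sub (Qi n) (Qi m)).
  apply/cvge0_oo2P => [nm|e e0].
    apply: expectation_ge0 => x.
    by rewrite mulr_ge0// indicE.
  have ec0 : (0 < e / c)%R by rewrite divr_gt0.
  have [N HN] := uniformly_integrable_cauchy QP UI KX Xi Xc ec0.
  exists N => n m Nn Nm.
  apply: le_trans (le_expectation_indic mA c0 PAQ _ (XQ n m)) _ => //.
  by rewrite lee_fin mulrC -ler_pdivlMr// HN.
- move=> H A mA PA0.
  have PA0' : (0 < fine (P A))%R by rewrite fine_gt0// PA0 ltey_eq fin_num_measure.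
  (* With [eps = P A], the set [B] has probability above [1 - P A], so it cannot lie almost surely
     outside [A]. *)
  have [B [mB PB BX]] := H _ PA0'.
  have mBA : measurable (B `&` A) by exact: measurableI.
  exists (B `&` A); split => //; last first.
    move=> X KX Xc; apply: (@cauchy_in_L1_onS _ _ _ P _ B) => //.
    - by move=> n; exact: Ki.
    - exact: BX.
  rewrite lt0e measure_ge0 andbT; apply/eqP => BA0.
  have : P B <= P (~` A).
    have -> : P B = P (B `\` A).
      rewrite measureD//; first by rewrite [X in _ - X]BA0 sube0.
      by rewrite -ge0_fin_numE ?fin_num_measure.
    rewrite le_measure ?inE//; first exact: measurableD; first exact: measurableC.
  rewrite probability_setC// -(@fineK _ (P A)) ?fin_num_measure// -EFinB.
  by move=> /(lt_le_trans PB); rewrite ltxx.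
- move=> H A mA PA0; have [B [mB BA PB0 BX]] := H _ mA PA0.
  exists B; split => //; apply/(uniformly_integrable_mul_indicP mB Ki KM).
  exact: (equi_integrable_of_cauchy mB Ki KM Kmid BX).
- move=> H.
  have [|B [mB eB PB]] := @equi_integrable_exhaustion _ _ _ P K Ki.
    move=> A mA /(H _ mA)[B [mB BA PB0]].
    by move=> /(uniformly_integrable_mul_indicP mB Ki KM) eB; exists B.
  exists (mixture_probability P mB); split.
  - by apply/null_content_dominatesP => A mA /(mixture_probability_eq0 mB PB mA).
  - by apply/null_content_dominatesP => A mA /(mixture_probability_eq0 mB PB mA).
  - exact: uniformly_integrable_mixture KM eB.
Qed.
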